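(* For every partition $\lambda$, with respect to the order $<_2$, \[ \sum_{\sigma\ \Phi\text{-degenerate}}(-1)^{m(\sigma)}q^{p(\sigma)+\mathrm{maj}(\sigma)}t^{\mathrm{quinv}(\sigma)}x^{|\sigma|}=0, \] the sum being over all $\Phi$-degenerate super fillings of $\mathrm{dg}(\lambda)$.
   Context: Let $\lambda=(\lambda_1\ge\dots\ge\lambda_k>0)$ be a partition; $\mathrm{dg}(\lambda)=\{(r,i):1\le i\le k,1\le r\le\lambda_i\}$, $(r,i)$ being row $r$ from the bottom and column $i$ from the left (columns bottom-justified of heights $\lambda_i$); $\mathrm{leg}((r,i))=\lambda_i-r$. $\mathcal A=\{1,\bar1,2,\bar2,\dots\}$ consists of positive letters $i$ and negative letters $\bar i$, $|i|=|\bar i|=i$, totally ordered by $<_2$: $0<1<2<3<\cdots<\bar3<\bar2<\bar1$. $I(a,b)=1$ if $a>b$ or $a=b$ is negative, and $I(a,b)=0$ if $a<b$ or $a=b$ is positive. A super filling is $\sigma:\mathrm{dg}(\lambda)\to\mathcal A$; a cell $u=(r,i)$, $r>1$, is a descent if $I(\sigma(u),\sigma((r-1,i)))=1$, and $\mathrm{maj}(\sigma)=\sum_{\text{descents }u}(\mathrm{leg}(u)+1)$. A triple is either three cells $(r+1,i),(r,i),(r,j)$ with $i<j$, or (degenerate) two cells $(r,i),(r,j)$ with $i<j$ and $\lambda_i=r$; with $a=\sigma((r+1,i))$ ($a=0$ if degenerate), $b=\sigma((r,i))$, $c=\sigma((r,j))$, it is a quinv triple iff exactly one of $I(a,b)=1$,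 $I(c,b)=0$, $I(a,c)=0$ holds; $\mathrm{quinv}(\sigma)$ is their number. $x^{|\sigma|}=\prod_u x_{|\sigma(u)|}$; $p(\sigma),m(\sigma)$ are the numbers of positive, resp. negative, entries. The reading order goes through rows top to bottom, each row right to left. The distinguished label of $\sigma$ is the smallest positive integer $a$ such that some cell $(r,j)$ has $|\sigma((r,j))|=a$ and $r>a$; the distinguished cell is the first cell in reading order whose entry has absolute value $a$; $\sigma$ is $\Phi$-degenerate if $a$ exists and the distinguished cell belongs to some degenerate triple. *)

(* Defs.v *)
From mathcomp Require Import all_boot all_order all_algebra.
Set Implicit Arguments. Unset Strict Implicit. Unset Printing Implicit Defensive.
Import GRing.Theory.

(* A letter of the super alphabet: (|a|, a is negative).
   Positive letter i = (i,false), negative letter \bar i = (i,true), i >= 1.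
   The auxiliary value 0 (used for degenerate triples) is (0,false). *)
Definition letter := (nat * bool)%type.
Definition zero_letter : letter := (0, false).
Definition absl (a : letter) : nat := a.1.
Definition is_neg (a : letter) : bool := a.2.

(* The order <_2 : 0 < 1 < 2 < ... < \bar 3 < \bar 2 < \bar 1 *)
Definition lt2 (a b : letter) : bool :=
  if a.2 then b.2 && (b.1 < a.1) else b.2 || (a.1 < b.1).

Definition Iind (a b : letter) : bool := lt2 b a || ((a == b) && is_neg a).

Definition is_partition (lam : seq nat) : Prop :=
  sorted geq lam /\ all (fun n => 0 < n) lam.

(* lambda_i, 1-indexed *)
Definition lamc (lam : seq nat) (i : nat) : nat := nth 0 lam i.-1.

(* cells are (r, i): row r from the bottom, column i from the left *)
Definition cell := (nat * nat)%type.
Definition in_dg (lam : seq nat) (c : cell) : bool :=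
  [&& 1 <= c.2, c.2 <= size lam, 1 <= c.1 & c.1 <= lamc lam c.2].

Definition cells (lam : seq nat) : seq cell :=
  [seq (r, i) | i <- iota 1 (size lam), r <- iota 1 (lamc lam i)].

Definition leg (lam : seq nat) (c : cell) : nat := lamc lam c.2 - c.1.

Definition filling := nat -> nat -> letter.

Definition entry (s : filling) (c : cell) : letter := s c.1 c.2.

Definition maj (lam : seq nat) (s : filling) : nat :=
  \sum_(u <- cells lam | (1 < u.1) && Iind (entry s u) (s u.1.-1 u.2))
     (leg lam u + 1).

Definition quinv_trip (a b c : letter) : bool :=
  (Iind a b : nat) + (~~ Iind c b : nat) + (~~ Iind a c : nat) == 1.

Definition quinv_nondeg (lam : seq nat) (s : filling) : nat :=
  \sum_(u <- cells lam) \sum_(v <- cells lam)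
    [&& u.1 == v.1, u.2 < v.2, in_dg lam (u.1.+1, u.2)
      & quinv_trip (s u.1.+1 u.2) (entry s u) (entry s v)].

Definition deg_triple (lam : seq nat) (u v : cell) : bool :=
  [&& u.1 == v.1, u.2 < v.2 & lamc lam u.2 == u.1].

Definition quinv_deg (lam : seq nat) (s : filling) : nat :=
  \sum_(u <- cells lam) \sum_(v <- cells lam)
    (deg_triple lam u v && quinv_trip zero_letter (entry s u) (entry s v)).

Definition quinv (lam : seq nat) (s : filling) : nat :=
  quinv_nondeg lam s + quinv_deg lam s.

Definition npos (lam : seq nat) (s : filling) : nat :=
  count (fun u => ~~ is_neg (entry s u)) (cells lam).
Definition nneg (lam : seq nat) (s : filling) : nat :=
  count (fun u => is_neg (entry s u)) (cells lam).

Definition reading (lam : seq nat) : seq cell :=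
  [seq u <- [seq (r, i) | r <- rev (iota 1 (head 0 lam)),
                          i <- rev (iota 1 (size lam))] | in_dg lam u].

Definition dlabel (lam : seq nat) (s : filling) : option nat :=
  match [seq absl (entry s u) | u <- cells lam &
           (0 < absl (entry s u)) && (absl (entry s u) < u.1)] with
  | [::] => None
  | x :: l => Some (foldr minn x l)
  end.

Definition dcell (lam : seq nat) (s : filling) (a : nat) : option cell :=
  ohead [seq u <- reading lam | absl (entry s u) == a].

Definition in_deg_triple (lam : seq nat) (w : cell) : bool :=
  has (fun u => has (fun v => deg_triple lam u v && ((w == u) || (w == v)))
                    (cells lam)) (cells lam).

Definition phi_degenerate (lam : seq nat) (s : filling) : bool :=
  if dlabel lam s is Some a then
    if dcell lam s a is Some w then in_deg_triple lam w else false
  else false.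

Local Open Scope ring_scope.
Definition weight (R : comNzRingType) (lam : seq nat) (q t : R) (x : nat -> R)
    (s : filling) : R :=
  (-1) ^+ nneg lam s * q ^+ (npos lam s + maj lam s) * t ^+ quinv lam s
  * \prod_(u <- cells lam) x (absl (entry s u)).
Local Close Scope ring_scope.

(* super fillings with entries of absolute value <= N, encoded as tuples
   indexed by (the list) cells lam; (j, b) : 'I_N * bool is the letter of
   absolute value j+1, negative iff b. *)
Definition fill (lam : seq nat) (N : nat)
    (e : (size (cells lam)).-tuple ('I_N * bool)) : filling :=
  fun r i => nth zero_letter [seq ((val p.1).+1, p.2) | p <- e]
                 (index (r, i) (cells lam)).

(* Main.v *)
Require Import Defs.
From mathcomp Require Import all_boot all_order all_algebra.
From mathcomp Require Import zify ring.
From Stdlib Require Import FunctionalExtensionality.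
Set Implicit Arguments. Unset Strict Implicit. Unset Printing Implicit Defensive.
Import GRing.Theory.

(** Fix the distinguished label [a] and the row [r] of the distinguished cell.
    That cell lies in a degenerate triple iff it tops one of the columns of
    height exactly [r] and there are at least two such columns.  Record the
    top row of this block as a word in [a], [bar a] and [y] (any other letter).

    Two operations act on the fillings with fixed [a] and [r].  Adjacent columns
    of height [r] can be exchanged from the top row down to a suitable row so
    that maj, and quinv outside the top row, do not change.  The sign of an
    entry of absolute value [a] can be flipped: as [a] and [bar a] are the
    extreme letters among those of absolute value at least [a], this preserves
    p + maj, and quinv except for the degenerate triples inside the block.
    Hence, up to the factor (-1)^neg t^coinv determined by the word, the sum
    over the fillings with a given word depends only on its length and on the
    number m > 0 of its letters of absolute value [a].  The sum of
    (-1)^neg t^coinv over these words is a t-binomial coefficient times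
    the product of the 1 - t^k for k < m, which vanishes because of k = 0. *)

(** * Exchange identities for a single triple *)

Lemma Iind_zero x : Iind zero_letter x = false.
Proof. by case: x => [n []]; rewrite /Iind /lt2 /zero_letter /= ?andbF. Qed.

(* Of the three conditions defining a quinv triple one or two always hold, so
   the indicator is linear in the values of [Iind]. *)
Lemma quinv_tripE a b c : quinv_trip a b c + Iind a b = Iind c b + Iind a c :> nat.
Proof.
case: a b c => [a []] [b []] [c []]; rewrite /quinv_trip /Iind /lt2 /is_neg /=;
  rewrite !xpair_eqE /= ?andbT ?andbF ?orbF;
  case: (ltngtP a b) => ab; case: (ltngtP a c) => ac; case: (ltngtP b c) => bc //=;
  exfalso; lia.
Qed.

Lemma Iind_total b c : b != c -> Iind b c + Iind c b = 1 :> nat.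
Proof.
case: b c => [b []] [c []]; rewrite /Iind /lt2 /is_neg /= !xpair_eqE /= ?andbT ?andbF ?orbF //;
  by case: ltngtP.
Qed.

Lemma quinv_trip_zero b c : quinv_trip zero_letter b c = Iind c b.
Proof. by have := quinv_tripE zero_letter b c; rewrite !Iind_zero !addn0; lia. Qed.

(** Subtracting the linear identities for [x] and [y] cancels [Iind b2 b1]. The conclusion says that
    exchanging the letters [x] and [y] above [b1] and [b2] keeps the number of descents. *)
Lemma Iind_exchange x y b1 b2 :
  quinv_trip x b1 b2 = quinv_trip y b1 b2 ->
  Iind y b1 + Iind x b2 = Iind x b1 + Iind y b2 :> nat.
Proof. by have := quinv_tripE x b1 b2; have := quinv_tripE y b1 b2; lia. Qed.

(** By [quinv_tripE] the two sides differ only in their terms [Iind] between the upper letters and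
    [b1], [b2], and these balance by [Iind_exchange]. *)
Lemma quinv_trip_exchange x y b1 b2 c :
  quinv_trip x b1 b2 = quinv_trip y b1 b2 ->
  quinv_trip y b1 c + quinv_trip x b2 c = quinv_trip x b1 c + quinv_trip y b2 c :> nat.
Proof.
move=> /Iind_exchange.
have := quinv_tripE x b1 c; have := quinv_tripE y b1 c.
have := quinv_tripE x b2 c; have := quinv_tripE y b2 c.
do !move: (nat_of_bool _) => ?; lia.
Qed.

(** If [b1 = b2], the indicator is [Iind b1 b1] for every upper letter, against the hypothesis.
    Otherwise the indicators of [y b1 b2] and [y b2 b1] add up to 1, so exactly one of them
    holds. *)
Lemma quinv_trip_swap x y b1 b2 :
  quinv_trip x b1 b2 != quinv_trip y b1 b2 ->
  quinv_trip y b2 b1 = quinv_trip x b1 b2.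
Proof.
have := quinv_tripE x b1 b2; have := quinv_tripE y b1 b2; have := quinv_tripE y b2 b1.
have [->|/Iind_total] := eqVneq b1 b2; lia.
Qed.

(** * Adjacent transpositions and sums over pairs of columns *)

Definition transp (j i : nat) : nat := if i == j then j.+1 else if i == j.+1 then j else i.

Lemma transp_l j : transp j j = j.+1. Proof. by rewrite /transp eqxx. Qed.
Lemma transp_r j : transp j j.+1 = j. Proof. by rewrite /transp eqxx gtn_eqF. Qed.
Lemma transp_lt j i : i < j -> transp j i = i.
Proof. by rewrite /transp => h; rewrite !ltn_eqF // ltnW. Qed.
Lemma transp_gt j i : j.+1 < i -> transp j i = i.
Proof. by rewrite /transp => h; rewrite !gtn_eqF // ltnW. Qed.
Lemma transpK j : involutive (transp j).
Proof. by move=> i; rewrite /transp; do !case: eqP => //=; lia. Qed.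

Lemma sum_pair (m j n : nat) (F G : nat -> nat) : m <= j -> j.+1 < n ->
  F j + F j.+1 = G j + G j.+1 ->
  (forall i, m <= i < n -> i != j -> i != j.+1 -> F i = G i) ->
  \sum_(m <= i < n) F i = \sum_(m <= i < n) G i.
Proof.
move=> mj jn FG off.
rewrite !(big_cat_nat (n := j) (m := m) (p := n)) ?(ltnW (ltnW jn)) //=.
rewrite !(@big_ltn _ _ _ j n) ?(ltnW jn) // !(@big_ltn _ _ _ j.+1 n) //=.
rewrite !(addnA (_ j)) FG; congr (_ + (_ + _)); apply: eq_big_nat => i; move=> h; apply: off; lia.
Qed.

Definition tri_sum (c : nat) (H : nat -> nat -> nat) : nat :=
  \sum_(1 <= i < c.+1) \sum_(i.+1 <= k < c.+1) H i k.

Lemma eq_tri_sum c (H H' : nat -> nat -> nat) :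
  (forall i k, 0 < i -> i < k -> k <= c -> H i k = H' i k) ->
  tri_sum c H = tri_sum c H'.
Proof. by move=> e; apply: eq_big_nat => i hi; apply: eq_big_nat => k hk; apply: e; lia. Qed.

(** Relabelling permutes the pairs [i < k], except that [(j, j+1)] becomes [(j+1, j)]. The condition
    [j != c] means that a row of length [c] contains both columns or neither. *)
Lemma tri_sum_swap c j H : 0 < j -> j != c ->
  tri_sum c (fun i k => H (transp j i) (transp j k)) + (j < c) * H j j.+1 =
  tri_sum c H + (j < c) * H j.+1 j.
Proof.
move=> j0 jc; case: (ltnP j c) => hj; last first.
  rewrite !mul0n !addn0; apply: eq_tri_sum => i k h1 h2 h3; rewrite !transp_lt //; lia.
rewrite !mul1n /tri_sum !(big_cat_nat (n := j) (m := 1) (p := c.+1)) //= ?leqW ?(ltnW hj) //.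
rewrite !(@big_ltn _ _ _ j c.+1) ?ltnS ?(ltnW hj) //.
rewrite !(@big_ltn _ _ _ j.+1 c.+1) ?ltnS //=.
set a := \sum_(1 <= i < j) _; set a' := \sum_(1 <= i < j) _.
have -> : a = a'.
  apply: eq_big_nat => i hi; apply: (sum_pair (j := j)); rewrite ?ltnS //; first by lia.
    by rewrite transp_l transp_r addnC (transp_lt (i := i)) //; lia.
  by move=> k hk n1 n2; rewrite /transp (negbTE n1) (negbTE n2) !ifF //; lia.
rewrite transp_l !transp_r.
have e1 : \sum_(j.+2 <= i < c.+1) \sum_(i.+1 <= k < c.+1) H (transp j i) (transp j k) =
          \sum_(j.+2 <= i < c.+1) \sum_(i.+1 <= k < c.+1) H i k.
  by apply: eq_big_nat => i hi; apply: eq_big_nat => k hk; rewrite !transp_gt //; lia.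
have e2 x : \sum_(j.+2 <= k < c.+1) H x (transp j k) = \sum_(j.+2 <= k < c.+1) H x k.
  by apply: eq_big_nat => k hk; rewrite transp_gt //; lia.
rewrite e1 !e2; lia.
Qed.

(** This is the exchange of the upper row alone: the hypothesis keeps the triple on columns [j],
    [j+1], and [quinv_trip_exchange] balances the triples of these two columns with each later
    column. *)
Lemma tri_sum_exchange c j (A B : nat -> letter) : 0 < j -> j != c ->
  quinv_trip (A j) (B j) (B j.+1) = quinv_trip (A j.+1) (B j) (B j.+1) ->
  tri_sum c (fun i k => quinv_trip (A (transp j i)) (B i) (B k)) =
  tri_sum c (fun i k => quinv_trip (A i) (B i) (B k)).
Proof.
move=> j0 jc e; case: (ltnP j c) => hj; last first.
  by apply: eq_tri_sum => i k h1 h2 h3; rewrite transp_lt //; lia.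
apply: (sum_pair (j := j)); rewrite ?ltnS //.
  rewrite !(@big_ltn _ _ _ j.+1 c.+1) ?ltnS //= transp_l transp_r -e -!addnA -!big_split /=; congr (_ + _).
  by apply: eq_big_nat => k _; apply: quinv_trip_exchange.
by move=> i hi n1 n2; apply: eq_bigr => k _; rewrite /transp (negbTE n1) (negbTE n2).
Qed.

(** * Row decomposition of maj and quinv *)

Definition conj_part (lam : seq nat) (r : nat) : nat := count (leq r) lam.

(** Heights decrease weakly to the right, so row [r] occupies the leftmost [conj_part lam r]
    columns. *)
Lemma leq_lamc lam r i : is_partition lam -> 0 < r -> 0 < i ->
  (r <= lamc lam i) = (i <= conj_part lam r).
Proof.
case=> lam_sorted _ r0; case: i => // i _; rewrite /lamc /conj_part /=.
elim: lam lam_sorted i => [|x l IH] /=; first by move=> _ i; rewrite nth_nil; lia.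
rewrite path_sortedE; last by move=> a b c /=; lia.
case/andP => /allP xl sl i; case: (leqP r x) => /= xr.
  by case: i => [|i]; rewrite /= ?xr // IH.
have c0 : count (leq r) l = 0.
  by apply/eqP; rewrite -leqn0 leqNgt -has_count; apply/hasPn => y /xl /= yx; rewrite -ltnNge; lia.
by case: i => [|i] /=; rewrite ?IH // c0; lia.
Qed.

Lemma in_dg_conj lam r i : is_partition lam ->
  in_dg lam (r, i) = [&& 0 < r, 0 < i & i <= conj_part lam r].
Proof.
move=> lamP; rewrite /in_dg /=; case: r => [|r]; first by rewrite /= !andbF.
case: i => [|i] //=; rewrite leq_lamc //=; case: leqP => //= h; apply/esym/negbTE.
by rewrite -leqNgt; apply: leq_trans h; exact: count_size.
Qed.

Lemma mem_cells lam u : (u \in cells lam) = in_dg lam u.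
Proof.
case: u => r i; rewrite /in_dg /=; apply/allpairsPdep/idP => [[i' [r' [h1 h2 [-> ->]]]]|h].
  by move: h1 h2; rewrite !mem_iota; lia.
by exists i, r; rewrite !mem_iota; split => //; lia.
Qed.

Lemma cells_uniq lam : uniq (cells lam).
Proof.
apply: allpairs_uniq_dep => [|i _|[a b] [c d] _ _ /= [-> ->]//]; exact: iota_uniq.
Qed.

Lemma cells_row_perm lam : is_partition lam ->
  perm_eq (cells lam) [seq (r, i) | r <- index_iota 1 (head 0 lam).+1, i <- index_iota 1 (conj_part lam r).+1].
Proof.
move=> lamP; apply: uniq_perm; first exact: cells_uniq.
  apply: allpairs_uniq_dep => [|i _|[a b] [c d] _ _ /= [-> ->]//]; exact: iota_uniq.
case=> r i; rewrite mem_cells in_dg_conj //; apply/idP/allpairsPdep => [|[i' [r' [h1 h2 [-> ->]]]]].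
  move=> /and3P[r0 i0 ic]; exists r, i; rewrite !mem_index_iota; split => //; try lia.
  have : 1 <= conj_part lam r by lia.
  by rewrite -leq_lamc // /lamc /= nth0; lia.
by move: h1 h2; rewrite !mem_index_iota; lia.
Qed.

Lemma sum_cells lam (F : cell -> nat) : is_partition lam ->
  \sum_(u <- cells lam) F u =
  \sum_(1 <= r < (head 0 lam).+1) \sum_(1 <= i < (conj_part lam r).+1) F (r, i).
Proof. by move=> lamP; rewrite (perm_big _ (cells_row_perm lamP)) /= big_allpairs_dep. Qed.

(** Here [A] is row [r] and [B] is row [r-1], whereas in [quinv_row] the upper row [A] is row [r+1]
    and [B] is row [r]. *)
Definition maj_row (lam : seq nat) (r : nat) (A B : nat -> letter) : nat :=
  \sum_(1 <= i < (conj_part lam r).+1) (1 < r) * Iind (A i) (B i) * (lamc lam i - r + 1).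

Definition quinv_row (lam : seq nat) (r : nat) (A B : nat -> letter) : nat :=
  tri_sum (conj_part lam r) (fun i k => quinv_trip (A i) (B i) (B k)).

Lemma maj_rows lam s : is_partition lam ->
  maj lam s = \sum_(1 <= r < (head 0 lam).+1) maj_row lam r (s r) (s r.-1).
Proof.
move=> lamP; rewrite /maj big_mkcond sum_cells //=; apply: eq_bigr => r _.
apply: eq_bigr => i _; rewrite /leg /entry /=.
by case: (1 < r); case: Iind; rewrite /= ?mul0n ?mul1n.
Qed.

(** With the letter 0 outside the diagram, a degenerate triple is an ordinary triple whose upper
    letter is 0, and [quinv_row] treats both kinds alike. *)
Definition supported (lam : seq nat) (s : filling) : Prop :=
  forall r i, ~~ in_dg lam (r, i) -> s r i = zero_letter.

Lemma quinv_rows lam s : is_partition lam -> supported lam s ->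
  quinv lam s = \sum_(1 <= r < (head 0 lam).+1) quinv_row lam r (s r.+1) (s r).
Proof.
move=> lamP ss; rewrite /quinv /quinv_nondeg /quinv_deg -big_split /=.
under eq_bigr do rewrite -big_split /=.
rewrite sum_cells //; apply: eq_big_nat => r hr; apply: eq_big_nat => i hi.
rewrite sum_cells // (bigD1_seq r) ?mem_index_iota ?iota_uniq //= [X in _ + X]big1 ?addn0; last first.
  move=> r' nr; rewrite big1 // => k _.
  by rewrite /deg_triple /= eq_sym (negbTE nr).
rewrite (big_cat_nat (n := i.+1)) //=; last by lia.
rewrite big_nat_cond big1 ?add0n; last first.
  by move=> k /andP[/andP[_ h] _]; rewrite /deg_triple /= ltnNge -ltnS h /= eqxx.
apply: eq_big_nat => k hk; rewrite /deg_triple /entry /= eqxx.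
have -> : i < k by lia.
rewrite /= in_dg_conj //=.
have : r <= lamc lam i by rewrite leq_lamc //; lia.
have h0 : 0 < i by lia.
have h1 : (r < lamc lam i) = (i <= conj_part lam r.+1) by rewrite leq_lamc.
rewrite h0 -h1 /=; case: ltngtP => //= e _; first by rewrite addn0.
by rewrite (ss r.+1 i) // in_dg_conj //= h0 /= -h1 e ltnn.
Qed.

(** * Exchanging adjacent columns of equal height *)

(* Row [r] of columns [j], [j+1] must be exchanged together with row [r+1]
   exactly when exchanging row [r+1] alone would alter a triple. *)
Definition swap_diff (j : nat) (s : filling) (r : nat) : bool :=
  quinv_trip (s r.+1 j) (s r j) (s r j.+1) != quinv_trip (s r.+1 j.+1) (s r j) (s r j.+1).

(** The exchange starts in row [h], continues downwards while [swap_diff] holds, and stops for good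
    at the first row where it fails. Rows above [h] count as exchanged; columns of height [h] have
    no cells there. *)
Definition swapped (h j : nat) (s : filling) (r : nat) : bool :=
  all (swap_diff j s) (index_iota r h).

Definition col_swap (h j : nat) (s : filling) : filling :=
  fun r i => s r (if swapped h j s r then transp j i else i).

Definition swap_cell (h j : nat) (s : filling) (u : cell) : cell :=
  (u.1, if swapped h j s u.1 then transp j u.2 else u.2).

Lemma swappedT h j s r : h <= r -> swapped h j s r.
Proof. by rewrite /swapped /index_iota -subn_eq0 => /eqP ->. Qed.

Lemma swappedS h j s r : r < h -> swapped h j s r = swap_diff j s r && swapped h j s r.+1.
Proof. by move=> rh; rewrite /swapped /index_iota -(subnSK rh). Qed.

(** The indicators of [x b1 b2] and [x b2 b1] have the sum [Iind b1 b2 + Iind b2 b1], which does not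
    depend on [x]. *)
Lemma quinv_trip_neq_sym x y b1 b2 :
  (quinv_trip x b2 b1 != quinv_trip y b2 b1) = (quinv_trip x b1 b2 != quinv_trip y b1 b2).
Proof.
have := quinv_tripE x b1 b2; have := quinv_tripE x b2 b1.
have := quinv_tripE y b1 b2; have := quinv_tripE y b2 b1.
by case: (quinv_trip x b1 b2); case: (quinv_trip x b2 b1); case: (quinv_trip y b1 b2);
  case: (quinv_trip y b2 b1) => //=; lia.
Qed.

(** [swap_diff] is symmetric under exchanging either of its two rows. Hence a second application of
    [col_swap] exchanges the same rows, which makes it an involution. *)
Lemma swap_diff_col_swap h j s r : swap_diff j (col_swap h j s) r = swap_diff j s r.
Proof.
rewrite /swap_diff /col_swap; case: (swapped h j s r); case: (swapped h j s r.+1);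
  by rewrite ?transp_l ?transp_r // ?(quinv_trip_neq_sym _ _ (s r j)) // eq_sym.
Qed.

Lemma swapped_col_swap h j s r : swapped h j (col_swap h j s) r = swapped h j s r.
Proof. by apply: eq_all => r'; apply: swap_diff_col_swap. Qed.

Lemma col_swapK h j s : col_swap h j (col_swap h j s) = s.
Proof.
apply: functional_extensionality => r; apply: functional_extensionality => i.
by rewrite {1}/col_swap swapped_col_swap /col_swap; case: swapped; rewrite ?transpK.
Qed.

Lemma swap_cellK h j s : involutive (swap_cell h j s).
Proof. by case=> r i; rewrite /swap_cell /=; case: swapped; rewrite ?transpK. Qed.

(** As columns [j] and [j+1] have equal height, no row ends between them. *)
Lemma ltn_conj_part lam h j r : is_partition lam -> 0 < j ->
  lamc lam j = h -> lamc lam j.+1 = h -> 0 < r ->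
  ((j < conj_part lam r) = (r <= h)) * (j != conj_part lam r).
Proof.
move=> lamP j0 hj hj1 r0.
have := leq_lamc lamP r0 j0; have := leq_lamc lamP r0 (ltn0Sn j); rewrite hj hj1 => -> h1.
by split => //; apply/eqP => e; move: h1; rewrite -e ltnn leqnn.
Qed.

Lemma in_dg_swap lam h j s u : is_partition lam -> 0 < j ->
  lamc lam j = h -> lamc lam j.+1 = h -> in_dg lam (swap_cell h j s u) = in_dg lam u.
Proof.
move=> lamP j0 hj hj1; case: u => r i; rewrite /swap_cell /=; case: swapped => //.
rewrite !in_dg_conj //; case: (posnP r) => //= r0.
have [c1 c2] := ltn_conj_part lamP j0 hj hj1 r0.
rewrite /transp; case: eqP => [->|_]; first by lia.
by case: eqP => [->|_]; lia.
Qed.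

Lemma perm_swap_cells lam h j s : is_partition lam -> 0 < j ->
  lamc lam j = h -> lamc lam j.+1 = h -> perm_eq (map (swap_cell h j s) (cells lam)) (cells lam).
Proof.
move=> lamP j0 hj hj1; apply: uniq_perm; rewrite ?cells_uniq //.
  by rewrite (map_inj_uniq (inv_inj (@swap_cellK h j s))) cells_uniq.
move=> u; rewrite mem_cells; apply/mapP/idP => [[v]|uin].
  by rewrite mem_cells => vin ->; rewrite in_dg_swap.
by exists (swap_cell h j s u); rewrite ?swap_cellK // mem_cells in_dg_swap.
Qed.

Lemma quinv_row_col_swap lam h j s r : is_partition lam -> supported lam s ->
  0 < j -> 0 < r -> lamc lam j = h -> lamc lam j.+1 = h ->
  quinv_row lam r (col_swap h j s r.+1) (col_swap h j s r) + (r == h) * Iind (s r j.+1) (s r j) =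
  quinv_row lam r (s r.+1) (s r) + (r == h) * Iind (s r j) (s r j.+1).
Proof.
move=> lamP ss j0 r0 hj hj1; have [c1 c2] := ltn_conj_part lamP j0 hj hj1 r0.
have out k : (k == j) || (k == j.+1) -> s h.+1 k = zero_letter.
  move=> hk; apply: ss; rewrite /in_dg /=; case/orP: hk => /eqP ->; rewrite ?hj ?hj1 ltnn !andbF //.
have swp := tri_sum_swap (fun i k => quinv_trip (s r.+1 i) (s r i) (s r k)) j0 c2.
rewrite /quinv_row /col_swap; case: (ltngtP r h) => [rh|rh|rh].
(* Below the top row, rows [r+1] and [r] are both fixed, both exchanged, or only the upper one is
   exchanged. The second case needs [swap_diff] and the third its failure. *)
- rewrite !mul0n !addn0 (swappedS j s rh); case: (swapped h j s r.+1); rewrite ?andbF ?andbT //.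
  case: (boolP (swap_diff j s r)) => [d|]; last first.
    by rewrite negbK => /eqP d; apply: tri_sum_exchange.
  by move: swp; rewrite (quinv_trip_swap d) => /addIn.
- rewrite !mul0n !addn0 !swappedT ?leqW ?(ltnW rh) //.
  by apply: eq_tri_sum => i k h1 h2 h3; rewrite !transp_lt //; lia.
(* In the top row the letters above both columns are 0, so the triple on columns [j], [j+1] is a
   single value of [Iind]; this is the only change. *)
move: swp; rewrite c1 rh leqnn !mul1n !swappedT //.
by rewrite !out ?eqxx ?orbT // !quinv_trip_zero.
Qed.

Lemma sum_pick (m n r c : nat) : m <= r < n -> \sum_(m <= k < n) (k == r) * c = c.
Proof.
move=> rn; rewrite (bigD1_seq r) ?mem_index_iota ?iota_uniq //= eqxx mul1n big1 ?addn0 //.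
by move=> k /negbTE ->.
Qed.

Lemma lamc_head lam i : is_partition lam -> 0 < lamc lam i -> 0 < i -> lamc lam i <= head 0 lam.
Proof.
move=> lamP h0 i0; have := leq_lamc lamP h0 i0; rewrite leqnn => /esym h.
by rewrite -nth0 -[nth 0 lam 0]/(lamc lam 1) leq_lamc //; apply: leq_trans h.
Qed.

Lemma supported_col_swap lam h j s : is_partition lam -> supported lam s -> 0 < j ->
  lamc lam j = h -> lamc lam j.+1 = h -> supported lam (col_swap h j s).
Proof.
by move=> lamP ss j0 hj hj1 r i; rewrite -(in_dg_swap s (r, i) lamP j0 hj hj1) => /ss.
Qed.

Lemma quinv_col_swap lam h j s : is_partition lam -> supported lam s ->
  0 < j -> 0 < h -> lamc lam j = h -> lamc lam j.+1 = h ->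
  quinv lam (col_swap h j s) + Iind (s h j.+1) (s h j) = quinv lam s + Iind (s h j) (s h j.+1).
Proof.
move=> lamP ss j0 h0 hj hj1; rewrite !quinv_rows //; last exact: supported_col_swap.
have hr : 1 <= h < (head 0 lam).+1 by rewrite h0 ltnS -hj lamc_head // hj.
rewrite -(sum_pick (Iind (s h j.+1) (s h j)) hr) -(sum_pick (Iind (s h j) (s h j.+1)) hr) -!big_split /=.
apply: eq_big_nat => r /andP[r0 _]; have := quinv_row_col_swap lamP ss j0 r0 hj hj1.
by case: eqP => [->|_]; rewrite ?mul0n.
Qed.

(** Columns of equal height have equal legs in each row, so only the number of descents in the two
    columns matters. It changes neither when both rows are exchanged nor, by [Iind_exchange], where
    the exchange stops. *)
Lemma maj_col_swap lam h j s : is_partition lam -> 0 < j ->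
  lamc lam j = h -> lamc lam j.+1 = h -> maj lam (col_swap h j s) = maj lam s.
Proof.
move=> lamP j0 hj hj1; rewrite !maj_rows //.
apply: eq_big_nat => r /andP[r0 _]; rewrite /maj_row.
have [c1 c2] := ltn_conj_part lamP j0 hj hj1 r0.
case: r r0 c1 c2 => // [[|r]] _ c1 c2; first by rewrite !big1.
rewrite /col_swap [r.+2.-1]/=; case: (ltnP r.+1 h) => rh; last first.
  by apply: eq_big_nat => i hi; rewrite !transp_lt ?if_same //; lia.
rewrite (swappedS _ _ rh); case: (swapped h j s r.+2); rewrite ?andbF ?andbT //.
apply: (sum_pair (j := j)) => //; first by rewrite ltnS c1.
  rewrite hj hj1 transp_l transp_r -!mulnDl -!mulnDr; congr (_ * _ * _).
  case: (boolP (swap_diff j s r.+1)) => [d|]; first by rewrite addnC.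
  by rewrite negbK => /eqP /Iind_exchange.
by move=> i _ n1 n2; rewrite /transp (negbTE n1) (negbTE n2) if_same.
Qed.

(** * Words of the top row of a block, and the sign flip *)

(* [Some b] stands for a letter of absolute value [a], negative iff [b]. *)
Definition letter_pattern (a : nat) (x : letter) : option bool :=
  if absl x == a then Some (is_neg x) else None.

(* Agrees with [Iind y x] as soon as [x] or [y] has absolute value [a]; pairs of
   other letters are not counted. *)
Definition pcoinv (x y : option bool) : bool :=
  match x, y with
  | _, Some true => true
  | Some false, None => true
  | _, _ => false
  end.

Fixpoint coinv (p : seq (option bool)) : nat :=
  if p is x :: w then count (pcoinv x) w + coinv w else 0.

(** Among letters of absolute value at least [a], the letter [a] is the smallest and [bar a] the
    largest, so a comparison involving one of them is determined by the word. *)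
Lemma pcoinv_letter a b c : a <= absl b -> a <= absl c -> (absl b == a) || (absl c == a) ->
  pcoinv (letter_pattern a b) (letter_pattern a c) = Iind c b.
Proof.
case: b c => [b sb] [c sc]; rewrite /letter_pattern /Iind /lt2 /absl /is_neg /= !xpair_eqE.
case: (ltngtP a b) => [ab|//|ab] _; case: (ltngtP a c) => [ac|//|ac] _ //= _; subst;
  by case: sb; case: sc; rewrite /= ?eqxx ?ltnn ?andbF ?orbT //; lia.
Qed.

Lemma pcoinv_letter_le a b c : a <= absl b -> a <= absl c ->
  pcoinv (letter_pattern a b) (letter_pattern a c) <= Iind c b.
Proof.
move=> ab ac; case: (boolP ((absl b == a) || (absl c == a))) => [/pcoinv_letter -> //|].
by rewrite negb_or /letter_pattern => /andP[/negbTE -> /negbTE ->].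
Qed.

Lemma coinv_swap u x y v :
  coinv (u ++ x :: y :: v) + pcoinv y x = coinv (u ++ y :: x :: v) + pcoinv x y.
Proof. by elim: u => [|z u IH] /=; rewrite ?count_cat /=; lia. Qed.

Lemma coinv_le_sum a (f : nat -> letter) m n : (forall i, m <= i < n -> a <= absl (f i)) ->
  coinv [seq letter_pattern a (f i) | i <- index_iota m n] <=
  \sum_(m <= i < n) \sum_(i.+1 <= k < n) Iind (f k) (f i).
Proof.
move Ed: (n - m) => d; elim: d m Ed => [|d IH] m Ed ha.
  by rewrite /index_iota Ed.
have mn : m < n by lia.
rewrite (big_ltn mn) /index_iota Ed /=.
have -> : d = n - m.+1 by lia.
apply: leq_add; last by apply: IH => [|i hi]; [lia | apply: ha; lia].
rewrite count_map -sum1_count big_mkcond /= [X in X <= _]big_seq_cond [X in _ <= X]big_seq_cond.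
apply: leq_sum => k; rewrite andbT mem_iota => hk.
have := @pcoinv_letter_le a (f m) (f k); rewrite !ha; try lia.
by move=> /(_ isT isT); case: pcoinv.
Qed.

(* With an entry of absolute value [a < r] in row [r], this says that [a] is the
   distinguished label and [r] the row of the distinguished cell. *)
Definition admissible (lam : seq nat) (a r : nat) (s : filling) : bool :=
  all (fun u => ((a <= absl (entry s u)) || (u.1 <= absl (entry s u)))
                && ((r < u.1) ==> (absl (entry s u) != a))) (cells lam).

(** These are the columns of height exactly [r], at the right end of row [r]. *)
Definition block (lam : seq nat) (r : nat) : seq nat :=
  index_iota (conj_part lam r.+1).+1 (conj_part lam r).+1.

Definition pattern (lam : seq nat) (a r : nat) (s : filling) : seq (option bool) :=
  [seq letter_pattern a (s r i) | i <- block lam r].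

Lemma mem_block lam r i : is_partition lam -> 0 < r ->
  (i \in block lam r) = (0 < i) && (lamc lam i == r).
Proof.
move=> lamP r0; rewrite mem_index_iota; case: i => // i.
have := leq_lamc lamP r0 (ltn0Sn i); have := leq_lamc lamP (ltn0Sn r) (ltn0Sn i); lia.
Qed.

Lemma admissible_ge lam a r s q i : admissible lam a r s -> in_dg lam (q, i) -> a <= q ->
  a <= absl (s q i).
Proof.
by move=> /allP adm iq aq; have /= := adm (q, i); rewrite mem_cells iq /entry /= => /(_ isT); lia.
Qed.

Lemma admissible_gt lam a r s q i : admissible lam a r s -> in_dg lam (q, i) -> a <= q -> r < q ->
  a < absl (s q i).
Proof.
move=> adm iq aq rq; have := admissible_ge adm iq aq.
by move/allP: adm => /(_ (q, i)); rewrite mem_cells iq /entry /= rq => /(_ isT) /=; lia.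
Qed.

(** Each pair counted by [coinv] is a degenerate triple inside the block that [quinv] counts too.
    This makes the subtraction [quinv - coinv] in [rest_weight] a true difference. *)
Lemma coinv_le_quinv lam a r s : is_partition lam -> supported lam s -> a < r ->
  admissible lam a r s -> coinv (pattern lam a r s) <= quinv lam s.
Proof.
move=> lamP ss ar adm.
case: (leqP (conj_part lam r) (conj_part lam r.+1)) => hc.
  by rewrite /pattern /block /index_iota subSS (eqP hc).
have hr : 1 <= r < (head 0 lam).+1.
  have c0 : 1 <= conj_part lam r by lia.
  have := leq_lamc lamP (leq_ltn_trans (leq0n a) ar) (ltn0Sn 0).
  by rewrite c0 /lamc /= nth0; lia.
rewrite quinv_rows // (bigD1_seq r) ?mem_index_iota ?iota_uniq //=.
apply: leq_trans (leq_addr _ _).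
rewrite /quinv_row /tri_sum (big_cat_nat (n := (conj_part lam r.+1).+1)) //=; last by lia.
apply: leq_trans (leq_addl _ _).
apply: leq_trans (coinv_le_sum _) _ => [i hi|].
  by apply: admissible_ge adm _ _; [rewrite in_dg_conj //; lia | lia].
rewrite big_nat_cond [X in _ <= X]big_nat_cond; apply: leq_sum => i /andP[hi _]; apply: leq_sum => k _.
by rewrite (ss r.+1 i) ?quinv_trip_zero // in_dg_conj //; lia.
Qed.

Lemma admissible_col_swap lam a r h j s : is_partition lam -> 0 < j ->
  lamc lam j = h -> lamc lam j.+1 = h ->
  admissible lam a r (col_swap h j s) = admissible lam a r s.
Proof.
move=> lamP j0 hj hj1; rewrite /admissible -[RHS](perm_all _ (perm_swap_cells s lamP j0 hj hj1)).
by rewrite all_map.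
Qed.

Lemma count_col_swap (P : pred letter) lam h j s : is_partition lam -> 0 < j ->
  lamc lam j = h -> lamc lam j.+1 = h ->
  count (fun u => P (entry (col_swap h j s) u)) (cells lam) = count (fun u => P (entry s u)) (cells lam).
Proof.
move=> lamP j0 hj hj1; rewrite -[RHS](permP (perm_swap_cells s lamP j0 hj hj1)).
by rewrite count_map.
Qed.

(** Here [j] is the column carrying [x]; row [r] is the top row of the block and so is always
    exchanged. *)
Lemma pattern_col_swap lam a r s u x y v : let j := (conj_part lam r.+1).+1 + size u in
  pattern lam a r s = u ++ x :: y :: v ->
  pattern lam a r (col_swap r j s) = u ++ y :: x :: v.
Proof.
move=> j; rewrite /pattern /block /index_iota; set m := (_ - _).
set J := (conj_part lam r.+1).+1 => e.
have em : m = size u + (size v).+2 by have := congr1 size e; rewrite size_map size_iota size_cat.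
move: e; rewrite em iotaD !map_cat /= => /eqP; rewrite eqseq_cat ?size_map ?size_iota //.
case/andP => /eqP eu /eqP [ex ey ev]; rewrite -/j in ex ey ev *.
rewrite -[in RHS]eu -ex -ey -[in RHS]ev /col_swap swappedT // transp_l transp_r; congr (_ ++ _ :: _ :: _).
  by apply/eq_in_map => i; rewrite mem_iota => hi; rewrite transp_lt //; lia.
by apply/eq_in_map => i; rewrite mem_iota => hi; rewrite transp_gt //; lia.
Qed.

Definition flip_cell (c : cell) (s : filling) : filling :=
  fun r i => if (r, i) == c then (absl (s r i), ~~ is_neg (s r i)) else s r i.

Lemma flip_cellK c s : flip_cell c (flip_cell c s) = s.
Proof.
apply: functional_extensionality => r; apply: functional_extensionality => i.
by rewrite /flip_cell; case: eqP => // _; case: (s r i) => n b; rewrite /= negbK.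
Qed.

Lemma absl_flip_cell c s r i : absl (flip_cell c s r i) = absl (s r i).
Proof. by rewrite /flip_cell; case: eqP. Qed.

Lemma admissible_flip_cell lam a r c s : admissible lam a r (flip_cell c s) = admissible lam a r s.
Proof. by apply: eq_all => u; rewrite /entry absl_flip_cell. Qed.

Lemma Iind_pos_min a c : a <= absl c -> Iind (a, false) c = false.
Proof. case: c => n []; rewrite /Iind /lt2 /absl /is_neg /= ?andbF ?orbF //=; lia. Qed.

Lemma Iind_neg_max a c : a <= absl c -> Iind (a, true) c.
Proof. by case: c => n []; rewrite /Iind /lt2 /absl /is_neg //= xpair_eqE andbT; lia. Qed.

Lemma Iind_above_pos a c : a < absl c -> Iind c (a, false).
Proof. by case: c => n []; rewrite /Iind /lt2 /absl /is_neg //= => ->. Qed.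

Lemma Iind_above_neg a c : a < absl c -> Iind c (a, true) = false.
Proof. by case: c => n []; rewrite /Iind /lt2 /absl /is_neg //= xpair_eqE ?andbT; lia. Qed.

(** The flipped cell tops its column, so its leg is 0, and the letter below has absolute value at
    least [a]. Hence [a] is no descent there while [bar a] is one, contributing 1. *)
Lemma maj_flip lam a r s : let J := (conj_part lam r.+1).+1 in is_partition lam ->
  J <= conj_part lam r -> 0 < a -> a < r -> admissible lam a r s -> s r J = (a, false) ->
  maj lam (flip_cell (r, J) s) = maj lam s + 1.
Proof.
move=> J lamP Jr a0 ar adm sJ; rewrite !maj_rows //.
have hJ : lamc lam J = r.
  have /andP[_ /eqP ->//] : (0 < J) && (lamc lam J == r).
    by rewrite -mem_block ?mem_index_iota ?ltnS //; lia.
have hr : 1 <= r < (head 0 lam).+1 by rewrite ltnS -{2}hJ lamc_head ?hJ //; lia.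
rewrite -[X in _ = _ + X](sum_pick 1 hr) -big_split /=; apply: eq_big_nat => q /andP[q0 _].
rewrite muln1 /maj_row.
have -> : (q == r) = \sum_(1 <= i < (conj_part lam q).+1) (i == J) * (q == r) :> nat.
  case: eqP => [->|_]; last by rewrite big1 // => i _; rewrite muln0.
  by rewrite sum_pick //.
rewrite -big_split /=; apply: eq_big_nat => i /andP[i0 ic].
(* Row [r+1] ends before column [J], so the flipped cell is never the lower cell of a comparison. *)
have iJq : q = r.+1 -> i < J by move=> e; rewrite e in ic.
rewrite /flip_cell !xpair_eqE.
have -> : (q.-1 == r) && (i == J) = false by lia.
case: (eqVneq q r) => [eq|] /=; last by rewrite muln0 addn0.
case: (eqVneq i J) => [ei|]; last by rewrite mul0n addn0.
rewrite eq ei sJ hJ subnn /=.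
have low : a <= absl (s r.-1 J).
  apply: admissible_ge adm _ _; last by lia.
  have r1 : 0 < r.-1 by lia.
  by rewrite in_dg_conj // -leq_lamc // hJ leq_pred r1.
by rewrite Iind_pos_min // Iind_neg_max //; lia.
Qed.

Lemma supported_flip lam c s : in_dg lam c -> supported lam s -> supported lam (flip_cell c s).
Proof.
move=> cin ss r i ni; rewrite /flip_cell; case: eqP => [e|_]; last exact: ss.
by rewrite e cin in ni.
Qed.

Lemma count_pcoinv a b (f : nat -> letter) m n : (forall k, m <= k < n -> a <= absl (f k)) ->
  count (pcoinv (Some b)) [seq letter_pattern a (f k) | k <- index_iota m n] =
  \sum_(m <= k < n) Iind (f k) (a, b).
Proof.
move=> ha; rewrite count_map -sum1_count big_mkcond /=; apply: eq_big_nat => k /ha ak.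
have := @pcoinv_letter a (a, b) (f k); rewrite /absl /= leqnn eqxx ak => /(_ isT isT isT) <-.
by rewrite /letter_pattern eqxx.
Qed.

(** Only row [q = r-1] sees the flipped cell, as the upper letter of its triples. Both [a] and
    [bar a] compare in the same way with the two lower letters, so the indicator reduces to [Iind]
    of these. *)
Lemma quinv_row_flip lam a r s q : let J := (conj_part lam r.+1).+1 in is_partition lam ->
  J <= conj_part lam r -> 0 < q -> q != r -> a < r -> admissible lam a r s -> s r J = (a, false) ->
  quinv_row lam q (flip_cell (r, J) s q.+1) (flip_cell (r, J) s q) =
  quinv_row lam q (s q.+1) (s q).
Proof.
move=> J lamP Jr q0 qr ar adm sJ; apply: eq_tri_sum => i k i0 ik kc.
rewrite /flip_cell !xpair_eqE (negbTE qr) /=; case: eqP => //= eq; case: eqP => //= ei.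
have hb : a <= absl (s q i) by apply: admissible_ge adm _ _; [rewrite in_dg_conj //; lia | lia].
have hc : a <= absl (s q k) by apply: admissible_ge adm _ _; [rewrite in_dg_conj //; lia | lia].
rewrite eq ei sJ -ei /=; have := quinv_tripE (a, true) (s q i) (s q k).
have := quinv_tripE (a, false) (s q i) (s q k).
by rewrite !Iind_pos_min // !Iind_neg_max //; lia.
Qed.

Lemma quinv_row_flip_top lam a r s : let J := (conj_part lam r.+1).+1 in is_partition lam ->
  supported lam s ->
  J <= conj_part lam r -> a < r -> admissible lam a r s -> s r J = (a, false) ->
  quinv_row lam r (flip_cell (r, J) s r.+1) (flip_cell (r, J) s r)
    + \sum_(J.+1 <= k < (conj_part lam r).+1) Iind (s r k) (a, false) =
  quinv_row lam r (s r.+1) (s r) + \sum_(J.+1 <= k < (conj_part lam r).+1) Iind (s r k) (a, true).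
Proof.
move=> J lamP ss Jr ar adm sJ; rewrite /quinv_row /tri_sum.
rewrite !(big_cat_nat (n := J) (m := 1) (p := (conj_part lam r).+1)) //=; try lia.
rewrite !(@big_ltn _ _ _ J (conj_part lam r).+1) //.
have top k : flip_cell (r, J) s r.+1 k = s r.+1 k by rewrite /flip_cell xpair_eqE gtn_eqF.
have row k : k != J -> flip_cell (r, J) s r k = s r k.
  by move=> /negbTE e; rewrite /flip_cell xpair_eqE e andbF.
have outJ : s r.+1 J = zero_letter by apply: ss; rewrite in_dg_conj // ltnn !andbF.
have flipJ : flip_cell (r, J) s r J = (a, true) by rewrite /flip_cell eqxx sJ.
(* Columns left of [J] reach row [r+1], where all absolute values exceed [a]. With [J] as right
   cell, the flip from [a] to [bar a] turns [Iind c b] from 0 to 1 and [Iind a c] from 1 to 0, so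
   their sum is kept. *)
set x := \sum_(1 <= i < J) _; set y := \sum_(1 <= i < J) _; have -> : x = y.
  apply: eq_big_nat => i hi; apply: eq_big_nat => k hk.
  rewrite top row; last by lia.
  case: (eqVneq k J) => [->|kJ]; last by rewrite row.
  rewrite flipJ sJ.
  have hA : a < absl (s r.+1 i) by apply: admissible_gt adm _ _ _; [rewrite in_dg_conj //; lia | lia | lia].
  have hB : a <= absl (s r i) by apply: admissible_ge adm _ _; [rewrite in_dg_conj //; lia | lia].
  have := quinv_tripE (s r.+1 i) (s r i) (a, true).
  have := quinv_tripE (s r.+1 i) (s r i) (a, false).
  by rewrite Iind_pos_min // Iind_neg_max // Iind_above_pos // Iind_above_neg //; lia.
have e1 : \sum_(J.+1 <= k < (conj_part lam r).+1)
      quinv_trip (flip_cell (r, J) s r.+1 J) (flip_cell (r, J) s r J) (flip_cell (r, J) s r k) =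
   \sum_(J.+1 <= k < (conj_part lam r).+1) Iind (s r k) (a, true).
  by apply: eq_big_nat => k hk; rewrite top outJ flipJ quinv_trip_zero row //; lia.
have e2 : \sum_(J.+1 <= k < (conj_part lam r).+1)
      quinv_trip (s r.+1 J) (s r J) (s r k) =
   \sum_(J.+1 <= k < (conj_part lam r).+1) Iind (s r k) (a, false).
  by apply: eq_big_nat => k hk; rewrite outJ sJ quinv_trip_zero.
have e3 : \sum_(J.+1 <= i < (conj_part lam r).+1) \sum_(i.+1 <= k < (conj_part lam r).+1)
      quinv_trip (flip_cell (r, J) s r.+1 i) (flip_cell (r, J) s r i) (flip_cell (r, J) s r k) =
   \sum_(J.+1 <= i < (conj_part lam r).+1) \sum_(i.+1 <= k < (conj_part lam r).+1)
      quinv_trip (s r.+1 i) (s r i) (s r k).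
  by apply: eq_big_nat => i hi; apply: eq_big_nat => k hk; rewrite top !row //; lia.
by rewrite e1 e2 e3; lia.
Qed.

Lemma pattern_cons lam a r s : let J := (conj_part lam r.+1).+1 in J <= conj_part lam r ->
  pattern lam a r s = letter_pattern a (s r J) ::
    [seq letter_pattern a (s r i) | i <- index_iota J.+1 (conj_part lam r).+1].
Proof. by move=> J Jr; rewrite /pattern /block /index_iota (subSn Jr) subSS. Qed.

Lemma pattern_flip lam a r s : let J := (conj_part lam r.+1).+1 in J <= conj_part lam r ->
  pattern lam a r (flip_cell (r, J) s) = omap negb (letter_pattern a (s r J)) ::
    [seq letter_pattern a (s r i) | i <- index_iota J.+1 (conj_part lam r).+1].
Proof.
move=> J Jr; rewrite pattern_cons //; congr (_ :: _).
  by rewrite /flip_cell eqxx /letter_pattern /absl /is_neg /=; case: eqP.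
apply/eq_in_map => i; rewrite mem_index_iota => hi.
have /gtn_eqF iJ : J < i by lia.
by rewrite /flip_cell xpair_eqE iJ andbF.
Qed.

(** Only the degenerate triples with left cell [(r, J)] change, and they are exactly the pairs that
    the first letter of the word contributes to [coinv]. *)
Lemma quinv_flip lam a r s : let J := (conj_part lam r.+1).+1 in is_partition lam ->
  supported lam s ->
  J <= conj_part lam r -> a < r -> admissible lam a r s -> s r J = (a, false) ->
  quinv lam (flip_cell (r, J) s) + coinv (pattern lam a r s) =
  quinv lam s + coinv (pattern lam a r (flip_cell (r, J) s)).
Proof.
move=> J lamP ss Jr ar adm sJ.
have Jin : in_dg lam (r, J) by rewrite in_dg_conj //; lia.
have hr : 1 <= r < (head 0 lam).+1.
  have /and4P[_ _ /= r0 rJ] := Jin; rewrite ltnS; apply/andP; split => //.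
  by apply: (leq_trans rJ); apply: lamc_head => //; apply: (leq_trans _ rJ).
rewrite !quinv_rows //; last exact: supported_flip.
rewrite !(bigD1_seq r) ?mem_index_iota ?iota_uniq //=.
rewrite [X in _ + X + _](_ : _ = \sum_(1 <= q < (head 0 lam).+1 | q != r) quinv_row lam q (s q.+1) (s q)); last first.
  rewrite big_nat_cond [RHS]big_nat_cond; apply: eq_bigr => q /andP[/andP[q0 _] qr].
  exact: (quinv_row_flip lamP Jr q0 qr ar adm sJ).
have := quinv_row_flip_top lamP ss Jr ar adm sJ.
have ge k : J < k < (conj_part lam r).+1 -> a <= absl (s r k).
  by move=> hk; apply: admissible_ge adm _ _; [rewrite in_dg_conj //; lia | lia].
rewrite pattern_flip // pattern_cons // -/J sJ /letter_pattern {1 3}/absl /= eqxx /=.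
by rewrite !count_pcoinv //; lia.
Qed.

(** * The distinguished label and cell *)

Definition positive (lam : seq nat) (s : filling) : Prop :=
  forall u, u \in cells lam -> 0 < absl (entry s u).

Lemma foldr_minnP x l : foldr minn x l \in x :: l /\ forall y, y \in x :: l -> foldr minn x l <= y.
Proof.
elim: l => [|z l [IH1 IH2]] /=; first by rewrite inE; split => // y; rewrite inE => /eqP ->.
split.
  rewrite /minn; case: ifP => _; first by rewrite !inE eqxx orbT.
  by move: IH1; rewrite !inE => /orP[->|->]; rewrite ?orbT.
move=> y; rewrite geq_min !inE => /or3P[/eqP ->|/eqP ->|h]; rewrite ?leqnn ?orbT //.
  by rewrite IH2 ?orbT // inE eqxx.
by rewrite IH2 ?orbT // inE h orbT.
Qed.

Lemma dlabelP lam s a : positive lam s ->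
  dlabel lam s = Some a <->
  (exists2 u : cell, u \in cells lam & absl (entry s u) = a /\ a < u.1) /\
  (forall u : cell, u \in cells lam -> absl (entry s u) < u.1 -> a <= absl (entry s u)).
Proof.
move=> sp; rewrite /dlabel; set l := map _ _.
have lP y : y \in l <-> exists2 u : cell, u \in cells lam & absl (entry s u) = y /\ y < u.1.
  split=> [/mapP[u]|[u uc [uy yu]]].
    by rewrite mem_filter => /andP[/andP[_ h] uc] ->; exists u.
  by apply/mapP; exists u => //; rewrite mem_filter uy yu -uy sp.
case: l lP => [|x l] lP.
  by split=> // [[/lP]].
have [m1 m2] := foldr_minnP x l; split => [[<-]|[h1 h2]].
  by split=> [|u uc ur]; [apply/lP | apply/m2/lP; exists u].
congr Some; apply/eqP; rewrite eqn_leq m2 /=; last by apply/lP.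
by have [u uc [<- ur]] := (lP _).1 m1; apply: h2.
Qed.

Definition reading_lt (u v : cell) : bool := (v.1 < u.1) || ((u.1 == v.1) && (v.2 < u.2)).

Lemma pairwise_reading lam : pairwise reading_lt (reading lam).
Proof.
apply: pairwise_filter; have rev_iota n : pairwise gtn (rev (iota 1 n)).
  rewrite -sorted_pairwise ?rev_sorted ?iota_ltn_sorted // => x y z /= xy yz; exact: ltn_trans yz xy.
move: (rev _) (rev_iota (head 0 lam)) (rev _) (rev_iota (size lam)) => rs rsP cs csP.
elim: rs rsP => //= r rs IH /andP[/allP rP /IH h].
rewrite pairwise_cat h andbT; apply/andP; split.
  apply/allrelP => u v /mapP[i _ ->] /allpairsP[[r' i'] /= [hr' _ ->]].
  by have /= := rP _ hr'; rewrite /reading_lt /= => ->.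
rewrite pairwise_map; apply: sub_pairwise csP => i k /= ki.
by rewrite /reading_lt /= eqxx ki orbT.
Qed.

Lemma mem_reading lam u : is_partition lam -> (u \in reading lam) = (u \in cells lam).
Proof.
move=> lamP; rewrite mem_cells mem_filter; case: (boolP (in_dg lam u)) => //= uin.
apply/allpairsP; exists u; rewrite !mem_rev !mem_iota.
case: u uin => r i uin; have /and4P[/= h1 h2 h3 h4] := uin.
have := lamc_head lamP (leq_trans h3 h4) h1; split => //=; lia.
Qed.

Lemma dcell_first lam s a w : is_partition lam -> dcell lam s a = Some w ->
  [/\ w \in cells lam, absl (entry s w) = a &
   forall v : cell, v \in cells lam -> absl (entry s v) = a ->
     (v.1 < w.1) || ((v.1 == w.1) && (v.2 <= w.2))].
Proof.
move=> lamP; rewrite /dcell; set l := [seq u <- _ | _].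
have lP u : (u \in l) = (absl (entry s u) == a) && (u \in cells lam).
  by rewrite mem_filter mem_reading.
have : pairwise reading_lt l by apply: pairwise_filter; apply: pairwise_reading.
case: l lP => //= w' l lP /andP[/allP wl _] [<-].
have := lP w'; rewrite inE eqxx => /esym/andP[/eqP wa wc]; split => // v vc va.
have := lP v; rewrite va eqxx vc inE => /orP[/eqP ->|/wl]; first by rewrite eqxx leqnn orbT.
by rewrite /reading_lt; lia.
Qed.

Lemma dcell_some lam s a u : is_partition lam -> u \in cells lam -> absl (entry s u) = a ->
  exists w, dcell lam s a = Some w.
Proof.
move=> lamP uc ua; rewrite /dcell; set l := [seq u <- _ | _].
have : u \in l by rewrite mem_filter ua eqxx mem_reading.
by case: l => // w l _; exists w.
Qed.

Definition dkey (lam : seq nat) (s : filling) : option nat * option nat :=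
  (dlabel lam s, if dlabel lam s is Some a then omap fst (dcell lam s a) else None).

Lemma mem_block_cells lam r i : is_partition lam -> 0 < r -> i \in block lam r -> (r, i) \in cells lam.
Proof.
move=> lamP r0; rewrite mem_index_iota mem_cells in_dg_conj // r0 /=; lia.
Qed.

(** In a degenerate triple the right column has height [r] as well, because it reaches row [r] and
    is no taller than the left one. So both cells lie in the block. *)
Lemma phi_degenerate_key lam s a r : is_partition lam -> positive lam s ->
  phi_degenerate lam s && (dkey lam s == (Some a, Some r)) =
  [&& a < r, 1 < size (block lam r), admissible lam a r s & has isSome (pattern lam a r s)].
Proof.
move=> lamP sp; apply/andP/and4P => [[]|[ar br adm hs]].
  rewrite /phi_degenerate /dkey => ph /eqP[el]; rewrite el in ph *.
  case: (dcell lam s a) (@dcell_first lam s a) ph => // w /(_ w lamP erefl)[wc wa wfst] dt [wr].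
  have [[u uc [ua ur]] amin] := (dlabelP a sp).1 el.
  have ar : a < r by have := wfst u uc ua; lia.
  case/hasP: dt => -[ru cu] uc' /hasP[[rv cv] vc' /andP[/and3P[/= /eqP ruv cuv /eqP lu] wuv]].
  have rur : ru = r by rewrite -wr; case/orP: wuv => /eqP ->.
  have r0 : 0 < r by lia.
  rewrite -ruv in vc' wuv; rewrite rur in uc' vc' lu wuv.
  move: uc' vc'; rewrite !mem_cells !in_dg_conj // r0 /= => /andP[cu0 cuc] /andP[cv0 cvc].
  have cub : cu \in block lam r by rewrite mem_block // cu0 lu eqxx.
  have cvb : cv \in block lam r by move: cub; rewrite !mem_index_iota; lia.
  split => //.
  - by move: cub cvb; rewrite !mem_index_iota size_iota; lia.
  - apply/allP => -[q i] vc; have /= h := amin (q, i) vc; have /= h' := wfst (q, i) vc.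
    case: (eqVneq (absl (entry s (q, i))) a) => [ea|na] /=.
      by move/(_ ea): h'; rewrite ea leqnn implybF wr; lia.
    by rewrite implybT andbT; lia.
  apply/hasP; exists (letter_pattern a (s r w.2)).
    by apply/map_f; case/orP: wuv => /eqP ->.
  by rewrite /letter_pattern; move: wa; rewrite /entry wr => ->; rewrite eqxx.
have r0 : 0 < r by lia.
case/hasP: hs => x /mapP[i ib ->]; rewrite /letter_pattern; case: eqP => // ia _.
have ic := mem_block_cells lamP r0 ib.
have el : dlabel lam s = Some a.
  apply/dlabelP => //; split; first by exists (r, i).
  by move=> u uc; have /allP/(_ u uc) := adm; lia.
have [w ew] := @dcell_some lam s a (r, i) lamP ic ia.
have [wc wa wfst] := dcell_first lamP ew.
have hwi := wfst _ ic ia.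
have hwr : w.1 <= r by have /allP/(_ w wc) := adm; rewrite wa eqxx implybF; lia.
have wr : w.1 = r by move: hwi => /=; lia.
rewrite /phi_degenerate /dkey el ew /= wr eqxx; split => //.
case: w wr wc hwi {ew wa wfst hwr} => [rw cw] /= -> {rw} wc hwi.
(* Rows are read from right to left and the block ends its row: an entry of absolute value [a] in
   the block puts the distinguished cell weakly to its right, still in the block. *)
have wb : cw \in block lam r.
  by move: wc ib; rewrite mem_cells in_dg_conj // !mem_index_iota; lia.
have degP c c' : c \in block lam r -> c' \in block lam r -> c < c' ->
    (cw == c) || (cw == c') -> in_deg_triple lam (r, cw).
  move=> cb cb' cc h; apply/hasP; exists (r, c); first exact: mem_block_cells.
  apply/hasP; exists (r, c'); first exact: mem_block_cells.
  by rewrite /deg_triple /= eqxx cc !xpair_eqE eqxx h /= andbT; move: cb; rewrite mem_block // => /andP[].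
(* The partner in a degenerate triple is the first column of the block, or the second one if the
   distinguished cell is itself in the first. *)
case: (eqVneq cw (conj_part lam r.+1).+1) => [e|e].
  apply: (degP cw cw.+1); rewrite ?eqxx //.
  by move: br wb; rewrite size_iota !mem_index_iota e; lia.
apply: (degP (conj_part lam r.+1).+1 cw); rewrite ?eqxx ?orbT //.
  by move: br wb; rewrite size_iota !mem_index_iota; lia.
by move: wb; rewrite mem_index_iota; lia.
Qed.

(** * The signed sum over words *)

Fixpoint words (n : nat) : seq (seq (option bool)) :=
  if n is m.+1 then [seq x :: w | x <- [:: None; Some true; Some false], w <- words m] else [:: [::]].

Definition nsome (p : seq (option bool)) : nat := count isSome p.
Definition pneg (p : seq (option bool)) : nat := count (pred1 (Some true)) p.

Lemma words_uniq n : uniq (words n).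
Proof.
elim: n => // n IH; apply: allpairs_uniq => //.
by case=> x w [y w'] _ _ /= [-> ->].
Qed.

Lemma mem_words n p : (p \in words n) = (size p == n).
Proof.
elim: n p => [|n IH] [|x p] //.
  by apply/negbTE/negP => /allpairsP[[y w] [_ _]].
apply/allpairsP/eqP => [[[y w] /= [_ hw [_ ->]]]|[sp]].
  by move: hw; rewrite IH => /eqP ->.
by exists (x, p); rewrite IH sp eqxx; split => //; case: x => [[]|].
Qed.

Lemma count_pcoinv_None w : count (pcoinv None) w = pneg w.
Proof. by apply: eq_count => -[[]|]. Qed.

Lemma count_pcoinv_neg w : count (pcoinv (Some true)) w = pneg w.
Proof. by apply: eq_count => -[[]|]. Qed.

Lemma count_pcoinv_pos w : count (pcoinv (Some false)) w = pneg w + (size w - nsome w).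
Proof.
rewrite /pneg /nsome -(count_predC isSome w) addKn.
by elim: w => //= -[[]|] w /= ->; lia.
Qed.

Lemma perm_invariant (T : eqType) (U : Type) (A : seq T -> U) :
  (forall u x y v, A (u ++ x :: y :: v) = A (u ++ y :: x :: v)) ->
  forall p p', perm_eq p p' -> A p = A p'.
Proof.
move=> swapA p p' pp'; suff gen u s s' : perm_eq s s' -> A (u ++ s) = A (u ++ s') by apply: (gen [::]).
have front l : forall u' x v, A (u' ++ l ++ x :: v) = A (u' ++ x :: l ++ v).
  elim: l => //= y l IH u' x v.
  by rewrite -cat_rcons IH cat_rcons swapA.
elim: s u s' => [|x s IH] u s'; first by rewrite perm_sym => /perm_nilP ->.
move=> h; have xs' : x \in s' by rewrite -(perm_mem h) inE eqxx.
case/splitPr: xs' h => l v h; rewrite front -!(cat_rcons x); apply: IH.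
by rewrite -(perm_cons x) (perm_trans h) // -[x :: v]cat1s perm_catCA.
Qed.

(** Any [Some] letter can be moved to the front, given the sign [false] there and moved back. Words
    without negative letters are determined up to order by their length and number of [Some]
    letters. *)
Lemma pattern_invariant (U : Type) (A : seq (option bool) -> U) :
  (forall u x y v, A (u ++ x :: y :: v) = A (u ++ y :: x :: v)) ->
  (forall b w, A (Some b :: w) = A (Some (~~ b) :: w)) ->
  forall p p', size p = size p' -> nsome p = nsome p' -> A p = A p'.
Proof.
move=> swapA flipA p p' sp np; have permA := perm_invariant swapA.
pose f := omap (fun _ : bool => false).
have unsign u w : A (u ++ w) = A (u ++ map f w).
  elim: w u => [|x w IH] u //=; rewrite -cat_rcons IH cat_rcons; case: x => [b|] //=.
  have front c : A (u ++ Some c :: map f w) = A (Some c :: u ++ map f w).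
    by apply: permA; rewrite -cat1s perm_catCA.
  by rewrite !front; case: b => //; rewrite flipA.
rewrite (unsign [::] p) (unsign [::] p') /=; apply: permA; apply/allP => x _ /=.
have cN w : count_mem None (map f w) = size w - nsome w.
  rewrite /nsome -(count_predC isSome w) addKn count_map; apply: eq_count => -[] //.
have cS b w : count_mem (Some b) (map f w) = ~~ b * nsome w.
  by rewrite count_map; case: b; elim: w => //= -[c|] w /= ->; lia.
by case: x => [b|]; rewrite ?cN ?cS ?sp np.
Qed.

Local Open Scope ring_scope.

Lemma sum_fiber (R : nmodType) (I : Type) (K : eqType) (s : seq I) (ks : seq K)
    (key : I -> K) (P : pred I) (F : I -> R) :
  uniq ks -> (forall i, P i -> key i \in ks) ->
  \sum_(i <- s | P i) F i = \sum_(k <- ks) \sum_(i <- s | P i && (key i == k)) F i.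
Proof.
move=> uks hk; rewrite (exchange_big_dep P) /=; last by move=> k i _ /andP[].
apply: eq_bigr => i Pi; rewrite Pi /= -big_filter.
have -> : [seq k <- ks | key i == k] = [:: key i].
  by rewrite (eq_filter (a2 := pred1 (key i))) ?filter_pred1_uniq ?hk // => k /=; rewrite eq_sym.
by rewrite big_seq1.
Qed.

(* Gaussian binomial coefficient (l + m choose m). *)
Fixpoint qbin (R : comNzRingType) (t : R) (l : nat) : nat -> R :=
  fix qbin_l (m : nat) : R :=
    match l, m with
    | 0, _ => 1
    | _, 0 => 1
    | l'.+1, m'.+1 => qbin t l' m + t ^+ l * qbin_l m'
    end.

Lemma qbin0 (R : comNzRingType) (t : R) m : qbin t 0 m = 1.
Proof. by case: m. Qed.
Lemma qbinl0 (R : comNzRingType) (t : R) l : qbin t l 0 = 1.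
Proof. by case: l. Qed.
Lemma qbinS (R : comNzRingType) (t : R) l m :
  qbin t l.+1 m.+1 = qbin t l m.+1 + t ^+ l.+1 * qbin t l.+1 m.
Proof. by []. Qed.
Arguments qbin : simpl never.

(** This is the second t-Pascal rule, the mirror image of the defining one under exchanging [l] and
    [m]. *)
Lemma qbin_pascal (R : comNzRingType) (t : R) l m :
  qbin t l.+1 m.+1 = t ^+ m.+1 * qbin t l m.+1 + qbin t l.+1 m.
Proof.
elim: l m => [|l IHl]; elim=> [|m IHm].
- by rewrite qbinS !qbin0 !qbinl0; ring.
- by rewrite qbinS [in LHS]IHm [in RHS]qbinS !qbin0 !exprS; ring.
- by rewrite qbinS [in LHS]IHl [in RHS]qbinS !qbinl0 !exprS; ring.
by rewrite qbinS [in LHS](IHl m.+1) [in LHS]IHm [qbin t l.+1 m.+2 in RHS]qbinS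
  [qbin t l.+2 m.+1 in RHS]qbinS !exprS; ring.
Qed.

(** The variable [z] generalizes the sign, recovered at [z = 1]. Every negative letter forms a
    counted pair with the first letter of the word, so removing that letter replaces [z] by
    [z * t]. *)
Definition word_sum (R : comNzRingType) (t : R) (n m : nat) (z : R) : R :=
  \sum_(p <- words n | nsome p == m) (- z) ^+ pneg p * t ^+ coinv p.

(** The terms come from the first letter: [None] gives the first sum, [Some false] the factor
    [t ^+ (n - m')] counting the [None] letters after it, and [Some true] the factor [- z]. *)
Lemma word_sum_rec (R : comNzRingType) (t : R) n m z :
  word_sum t n.+1 m z = word_sum t n m (z * t)
    + (if m is m'.+1 then (t ^+ (n - m') - z) * word_sum t n m' (z * t) else 0).
Proof.
rewrite /word_sum [words _.+1]/=; set W := words n.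
rewrite !big_cat /= ?big_nil ?addr0 !big_map /=; congr (_ + _).
  apply: eq_big => // p _; rewrite /pneg /= -/(pneg p) add0n count_pcoinv_None exprD mulrA.
  by rewrite -mulNr exprMn.
case: m => [|m].
  by rewrite !big_pred0 ?addr0 // => p; rewrite /nsome /= add1n.
rewrite mulrBl addrC mulr_sumr mulr_sumr -sumrN; congr (_ + _).
  rewrite [LHS]big_seq_cond [RHS]big_seq_cond; apply: eq_big => // p /andP[].
  rewrite mem_words => /eqP sp /eqP [np0]; have np : nsome p = m := np0.
  rewrite /pneg /= -/(pneg p) add0n count_pcoinv_pos sp np -mulNr exprMn !exprD.
  by ring.
apply: eq_big => // p _; rewrite /pneg /= -/(pneg p) count_pcoinv_neg -!mulNr exprMn !exprD expr1.
by ring.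
Qed.

Lemma word_sum_gt (R : comNzRingType) (t : R) n m z : (n < m)%N -> word_sum t n m z = 0.
Proof.
move=> nm; rewrite /word_sum big_seq_cond big_pred0 // => p; rewrite mem_words.
apply/negbTE/negP => /andP[/eqP sp /eqP np].
by have := count_size isSome p; rewrite -/(nsome p) sp np; lia.
Qed.

Lemma word_sum_prod (R : comNzRingType) (t : R) l m z :
  word_sum t (l + m) m z = qbin t l m * \prod_(k < m) (1 - z * t ^+ k).
Proof.
move En: (l + m)%N => n; elim: n l m z En => [|n IH] l m z En.
  have [-> ->] : l = 0%N /\ m = 0%N by lia.
  by rewrite big_ord0 /word_sum /= big_cons big_nil /= !expr0 !mulr1 addr0.
rewrite word_sum_rec; case: m En => [|m] En.
  have -> : word_sum t n 0 (z * t) = qbin t n 0 * \prod_(k < 0) (1 - z * t * t ^+ k) by apply: IH; rewrite addn0.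
  by rewrite !big_ord0 !qbinl0 addr0.
rewrite (IH l m _ ltac:(lia)).
have -> : (n - m = l)%N by lia.
have recl : \prod_(k < m.+1) (1 - z * t ^+ k) = (1 - z) * \prod_(k < m) (1 - z * t * t ^+ k).
  rewrite big_ord_recl /= expr0 mulr1; congr (_ * _); apply: eq_bigr => k _.
  by rewrite -mulrA -exprS.
rewrite recl; case: l En => [|l] En.
  rewrite word_sum_gt ?qbin0; last by lia.
  by rewrite expr0; ring.
rewrite (IH l m.+1 _ ltac:(lia)) big_ord_recr /=.
have -> : z * t * t ^+ m = z * t ^+ m.+1 by rewrite exprS mulrA.
set P := \prod_(i < m) _.
have e1 := qbinS t l m; have e2 := qbin_pascal t l m.
(* Collected by powers of [z], the constant term is the defining Pascal rule and the coefficient of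
   [- z] is the second one, so the factor [1 - z] splits off. *)
transitivity (((qbin t l m.+1 + t ^+ l.+1 * qbin t l.+1 m) - z * (t ^+ m.+1 * qbin t l m.+1 + qbin t l.+1 m)) * P); first by ring.
by rewrite -e1 -e2; ring.
Qed.

Lemma word_sum1 (R : comNzRingType) (t : R) n m : (0 < m)%N -> word_sum t n m 1 = 0.
Proof.
move=> m0; case: (ltnP n m) => nm; first exact: word_sum_gt.
rewrite -(subnK nm) word_sum_prod; case: m m0 nm => // m _ _.
by rewrite big_ord_recl /= expr0 mulr1 subrr mul0r mulr0.
Qed.

(** * Sums over fillings *)

Definition bounded (lam : seq nat) (N : nat) (s : filling) : Prop :=
  forall u, u \in cells lam -> (0 < absl (entry s u) <= N)%N.

Lemma fill_out lam N (e : (size (cells lam)).-tuple ('I_N * bool)) r i :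
  (r, i) \notin cells lam -> fill e r i = zero_letter.
Proof.
by move=> h; rewrite /fill nth_default // size_map size_tuple leqNgt index_mem.
Qed.

Lemma fill_supported lam N (e : (size (cells lam)).-tuple ('I_N * bool)) : supported lam (fill e).
Proof. by move=> r i; rewrite -mem_cells; apply: fill_out. Qed.

Lemma fill_nth lam N (e : (size (cells lam)).-tuple ('I_N * bool)) (k : 'I_(size (cells lam))) :
  entry (fill e) (nth (0, 0)%N (cells lam) k) = ((val (tnth e k).1).+1, (tnth e k).2).
Proof.
rewrite /entry /fill; case E: (nth (0, 0)%N (cells lam) k) => [r i] /=.
rewrite -E index_uniq ?cells_uniq // (nth_map (tnth e k)) ?size_tuple //.
by rewrite -tnth_nth.
Qed.

Lemma mem_cells_nth lam u : u \in cells lam ->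
  exists k : 'I_(size (cells lam)), u = nth (0, 0)%N (cells lam) k.
Proof.
by move=> uc; have h := uc; rewrite -index_mem in h; exists (Ordinal h); rewrite /= nth_index.
Qed.

Lemma fill_bounded lam N (e : (size (cells lam)).-tuple ('I_N * bool)) : bounded lam N (fill e).
Proof. by move=> u /mem_cells_nth[k ->]; rewrite fill_nth /absl /= ltn_ord. Qed.

Lemma fill_inj lam N : injective (@fill lam N).
Proof.
move=> e e' ee; apply: eq_from_tnth => k.
have : entry (fill e) (nth (0, 0)%N (cells lam) k) = entry (fill e') (nth (0, 0)%N (cells lam) k).
  by rewrite ee.
rewrite !fill_nth; case: (tnth e k) => a b; case: (tnth e' k) => a' b' /= [h ->].
by congr (_, _); apply: val_inj.
Qed.

(* [e0] only provides default values for [insubd]. *)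
Lemma fill_of lam N (e0 : (size (cells lam)).-tuple ('I_N * bool)) s :
  supported lam s -> bounded lam N s ->
  fill [tuple (insubd (tnth e0 k).1 (absl (entry s (nth (0, 0)%N (cells lam) k))).-1,
               is_neg (entry s (nth (0, 0)%N (cells lam) k))) | k < size (cells lam)] = s.
Proof.
move=> ss bs; apply: functional_extensionality => r; apply: functional_extensionality => i.
have [uc|un] := boolP ((r, i) \in cells lam); last by rewrite fill_out // ss // -mem_cells.
rewrite -[LHS]/(entry (fill _) (r, i)) -[RHS]/(entry s (r, i)).
have := bs _ uc; have [k ->] := mem_cells_nth uc => h; rewrite fill_nth tnth_mktuple /=.
move: h; case: (entry s _) => a b; rewrite /absl /is_neg /= => h.
by rewrite insubdK; [rewrite prednK //; lia | rewrite -topredE /=; lia].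
Qed.

(** [fill] is a bijection from tuples onto the supported bounded fillings, so an involution [T] of
    the latter lifts to an involution [h] of tuples. *)
Lemma fill_reindex (R : nmodType) lam N (T : filling -> filling) (P : pred filling) (F : filling -> R) :
  (forall s, supported lam s -> supported lam (T s)) ->
  (forall s, bounded lam N s -> bounded lam N (T s)) ->
  (forall s, T (T s) = s) ->
  \sum_(e | P (@fill lam N e)) F (fill e) = \sum_(e | P (T (@fill lam N e))) F (T (fill e)).
Proof.
move=> Ts Tb TK.
pose h (e : (size (cells lam)).-tuple ('I_N * bool)) :=
  [tuple (insubd (tnth e k).1 (absl (entry (T (fill e)) (nth (0, 0)%N (cells lam) k))).-1,
          is_neg (entry (T (fill e)) (nth (0, 0)%N (cells lam) k))) | k < size (cells lam)].
have hE e : fill (h e) = T (fill e).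
  by apply: fill_of; [apply/Ts/fill_supported | apply/Tb/fill_bounded].
have hK : involutive h by move=> e; apply: fill_inj; rewrite !hE TK.
rewrite (reindex_inj (inv_inj hK)); apply: eq_big => [e|e _]; by rewrite hE.
Qed.

(** This is the weight without the factor determined by the word. The sign exponents are added
    rather than subtracted, since only parity matters. *)
Definition rest_weight (R : comNzRingType) (lam : seq nat) (q t : R) (x : nat -> R)
    (a r : nat) (s : filling) : R :=
  (-1) ^+ (nneg lam s + pneg (pattern lam a r s)) * q ^+ (npos lam s + maj lam s)
  * t ^+ (quinv lam s - coinv (pattern lam a r s)) * \prod_(u <- cells lam) x (absl (entry s u)).

Lemma weight_pattern (R : comNzRingType) lam (q t : R) x a r s :
  (coinv (pattern lam a r s) <= quinv lam s)%N ->
  weight lam q t x s =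
  (-1) ^+ pneg (pattern lam a r s) * t ^+ coinv (pattern lam a r s) * rest_weight lam q t x a r s.
Proof.
move=> le; rewrite /weight /rest_weight -{1}(subnKC le) !exprD.
have := signrMK (pneg (pattern lam a r s)) (1 : R); rewrite mulr1 => sgn.
set p := (-1) ^+ pneg _ in sgn *; set n := (-1) ^+ _.
set A := q ^+ _; set A' := q ^+ _; set B := t ^+ _; set C := t ^+ _; set D := \prod_(_ <- _) _.
transitivity ((p * p) * (n * (A * A') * (B * C) * D)); last by ring.
by rewrite sgn mul1r.
Qed.

Definition pattern_sum (R : comNzRingType) (lam : seq nat) (N : nat) (q t : R) (x : nat -> R)
    (a r : nat) (p : seq (option bool)) : R :=
  \sum_(e | admissible lam a r (@fill lam N e) && (pattern lam a r (fill e) == p))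
     rest_weight lam q t x a r (fill e).

Lemma pattern_sum_size (R : comNzRingType) lam N (q t : R) x a r p :
  size p != size (block lam r) -> pattern_sum lam N q t x a r p = 0.
Proof.
move=> sp; apply: big_pred0 => e; apply/negbTE/negP => /andP[_ /eqP e1].
by rewrite -e1 size_map eqxx in sp.
Qed.

(** The column exchange maps the fillings with one word onto those with the other, and changes
    [quinv] by as much as [coinv]. *)
Lemma pattern_sum_swap (R : comNzRingType) lam N (q t : R) x a r u y z v : is_partition lam ->
  (a < r)%N -> pattern_sum lam N q t x a r (u ++ y :: z :: v) =
               pattern_sum lam N q t x a r (u ++ z :: y :: v).
Proof.
move=> lamP ar.
have [|sz] := eqVneq (size (u ++ y :: z :: v)) (size (block lam r)); last first.
  by rewrite !pattern_sum_size //; move: sz; rewrite !size_cat.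
rewrite size_cat size_iota /= => sz.
(* For two letters [None] the words coincide. Otherwise one of the two entries has absolute value
   [a], as [pcoinv_letter] requires. *)
have [/andP[/eqP-> /eqP->]//|yz] := boolP ((y == None) && (z == None)).
pose j := ((conj_part lam r.+1).+1 + size u)%N.
have r0 : (0 < r)%N by lia.
have lj k : (k == j) || (k == j.+1) -> lamc lam k = r.
  move=> hk; have : k \in block lam r by rewrite mem_index_iota; lia.
  by rewrite mem_block // => /andP[_ /eqP].
have hj := lj j ltac:(lia); have hj1 := lj j.+1 ltac:(lia).
have j0 : (0 < j)%N by [].
rewrite /pattern_sum (@fill_reindex R lam N (col_swap r j)
   (fun s => admissible lam a r s && (pattern lam a r s == u ++ y :: z :: v))
   (rest_weight lam q t x a r)).
- apply: eq_big => [e|e /andP[]]; rewrite admissible_col_swap //.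
    congr (_ && _); apply/eqP/eqP => h; last exact: pattern_col_swap.
    by rewrite -(col_swapK r j (fill e)); apply: pattern_col_swap.
  move=> adm /eqP pe.
  have pf : pattern lam a r (fill e) = u ++ z :: y :: v.
    by rewrite -(col_swapK r j (fill e)); apply: pattern_col_swap.
  have le := coinv_le_quinv lamP (fill_supported e) ar adm.
  have qs := quinv_col_swap lamP (fill_supported e) j0 r0 hj hj1.
  have cs := coinv_swap u y z v.
  have jb k : (k == j) || (k == j.+1) -> (a <= absl (fill e r k))%N.
    move=> hk; apply: admissible_ge adm _ (ltnW ar).
    by rewrite -mem_cells; apply: mem_block_cells => //; rewrite mem_index_iota; lia.
  have [zE yE] : letter_pattern a (fill e r j) = z /\ letter_pattern a (fill e r j.+1) = y.
    have eb k : (k < (size v).+2)%N ->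
        letter_pattern a (fill e r (j + k)%N) = nth None (z :: y :: v) k.
      move=> kv; have := congr1 (fun p => nth None p (size u + k)%N) pf.
      rewrite nth_cat ltnNge leq_addr /= addKn => <-.
      rewrite (nth_map 0%N) ?size_iota ?nth_iota; try lia.
      by rewrite /j addnA.
    by have := eb 0%N isT; have := eb 1%N isT; rewrite addn0 addn1.
  have some_a : (absl (fill e r j) == a) || (absl (fill e r j.+1) == a).
    move: yz; rewrite -zE -yE /letter_pattern.
    by case: (absl (fill e r j) == a); case: (absl (fill e r j.+1) == a).
  have c1 := pcoinv_letter (jb j ltac:(lia)) (jb j.+1 ltac:(lia)) some_a.
  have c2 := pcoinv_letter (jb j.+1 ltac:(lia)) (jb j ltac:(lia)) (etrans (orbC _ _) some_a).
  rewrite zE yE in c1 c2; rewrite pf in le.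
  rewrite /rest_weight pe pf maj_col_swap //.
  have -> : nneg lam (col_swap r j (fill e)) = nneg lam (fill e) by apply: (count_col_swap is_neg).
  have -> : npos lam (col_swap r j (fill e)) = npos lam (fill e).
    by apply: (count_col_swap (fun l => ~~ is_neg l)).
  have -> : pneg (u ++ y :: z :: v) = pneg (u ++ z :: y :: v) by rewrite /pneg !count_cat /=; lia.
  have -> : (quinv lam (col_swap r j (fill e)) - coinv (u ++ y :: z :: v) =
             quinv lam (fill e) - coinv (u ++ z :: y :: v))%N by rewrite -c1 -c2 in qs; lia.
  congr (_ * _); rewrite -[RHS](perm_big _ (perm_swap_cells (fill e) lamP j0 hj hj1)) /= big_map.
  by [].
- by move=> s ss; apply: supported_col_swap.
- move=> s bs w wc; apply: (bs (swap_cell r j s w)).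
  by rewrite mem_cells in_dg_swap // -mem_cells.
- exact: col_swapK.
Qed.

Lemma count_off (T : eqType) (s : seq T) (P P' : pred T) c : uniq s -> c \in s ->
  (forall u, u != c -> P u = P' u) -> (count P s + P' c = count P' s + P c)%N.
Proof.
move=> us cs off; rewrite -!sum1_count !(big_mkcond P) !(big_mkcond P') !(bigD1_seq c) //=.
rewrite [X in (_ + X + _)%N](eq_bigr (fun u => if P' u then 1%N else 0%N)); last by move=> u /off ->.
by case: (P c); case: (P' c); lia.
Qed.

(** The flip raises both [nneg] and [pneg] by 1, moves one unit from [npos] to [maj], and keeps
    [quinv - coinv]. *)
Lemma rest_weight_flip (R : comNzRingType) lam (q t : R) x a r s :
  let J := (conj_part lam r.+1).+1 in is_partition lam -> supported lam s ->
  (J <= conj_part lam r)%N -> (0 < a < r)%N -> admissible lam a r s -> s r J = (a, false) ->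
  rest_weight lam q t x a r (flip_cell (r, J) s) = rest_weight lam q t x a r s.
Proof.
move=> J lamP ss Jr /andP[a0 ar] adm sJ.
have Jc : (r, J) \in cells lam by rewrite mem_cells in_dg_conj //; lia.
have le := coinv_le_quinv lamP ss ar adm.
have qf := quinv_flip lamP ss Jr ar adm sJ.
have off u : u != (r, J) -> entry (flip_cell (r, J) s) u = entry s u.
  by case: u => r' i' /negbTE h; rewrite /entry /flip_cell h.
have at_c : entry (flip_cell (r, J) s) (r, J) = (a, true).
  by rewrite /entry /flip_cell eqxx /= -/J sJ.
have e_c : entry s (r, J) = (a, false) by [].
have nn : (nneg lam (flip_cell (r, J) s) = nneg lam s + 1)%N.
  have := @count_off _ _ (fun u => is_neg (entry (flip_cell (r, J) s) u)) (fun u => is_neg (entry s u))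
     _ (cells_uniq lam) Jc (fun u h => congr1 is_neg (off u h)).
  by rewrite at_c e_c /= addn0.
have np : (npos lam s = npos lam (flip_cell (r, J) s) + 1)%N.
  have := @count_off _ _ (fun u => ~~ is_neg (entry (flip_cell (r, J) s) u)) (fun u => ~~ is_neg (entry s u))
     _ (cells_uniq lam) Jc (fun u h => congr1 (fun l => ~~ is_neg l) (off u h)).
  by rewrite at_c e_c /= addn0.
have pn : (pneg (pattern lam a r (flip_cell (r, J) s)) = pneg (pattern lam a r s) + 1)%N.
  by rewrite pattern_flip // pattern_cons // -/J sJ /letter_pattern /absl /= eqxx /pneg /=; lia.
rewrite /rest_weight nn pn np (maj_flip lamP Jr a0 ar adm sJ).
rewrite (_ : (quinv lam (flip_cell (r, J) s) - _ = quinv lam s - coinv (pattern lam a r s))%N); last by rewrite -/J in qf; lia.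
rewrite !exprD !expr1; set P := \prod_(_ <- _) _; set P' := \prod_(_ <- _) _.
have -> : P = P' by apply: eq_bigr => u _; rewrite /entry absl_flip_cell.
by ring.
Qed.

Lemma pattern_sum_flip (R : comNzRingType) lam N (q t : R) x a r b w : is_partition lam ->
  (a < r)%N -> pattern_sum lam N q t x a r (Some b :: w) =
               pattern_sum lam N q t x a r (Some (~~ b) :: w).
Proof.
move=> lamP ar.
have [|sz] := eqVneq (size (Some b :: w)) (size (block lam r)); last by rewrite !pattern_sum_size.
rewrite size_iota /= => sz; pose J := (conj_part lam r.+1).+1.
have Jr : (J <= conj_part lam r)%N by rewrite /J; lia.
have Jc : (r, J) \in cells lam by rewrite mem_cells in_dg_conj //; lia.
rewrite /pattern_sum (@fill_reindex R lam N (flip_cell (r, J))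
   (fun s => admissible lam a r s && (pattern lam a r s == Some b :: w))
   (rest_weight lam q t x a r)).
- apply: eq_big => [e|e /andP[]]; rewrite admissible_flip_cell.
    congr (_ && _); rewrite pattern_flip // pattern_cons // -/J !eqseq_cons; congr (_ && _).
    by case: letter_pattern => [[]|]; case: b {sz}.
  move=> adm; rewrite pattern_flip // -/J eqseq_cons => /andP[/eqP h _].
  have sJ : absl (fill e r J) = a.
    by move: h; rewrite /letter_pattern; case: eqP.
  have a0 : (0 < a < r)%N.
    by rewrite ar andbT -sJ; have /andP[] := fill_bounded e Jc.
  (* [rest_weight_flip] goes from [a] to [bar a]; if the entry is already [bar a], it is applied to
     the flipped filling. *)
  case E: (fill e r J) sJ => [a' [|]]; rewrite /absl /= => ea; rewrite {}ea in E.
    rewrite -[in RHS](flip_cellK (r, J) (fill e)); apply/esym/rest_weight_flip => //.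
    + by apply: supported_flip; [rewrite -mem_cells | apply: fill_supported].
    + by rewrite admissible_flip_cell.
    by rewrite /flip_cell eqxx E.
  by apply: rest_weight_flip => //; apply: fill_supported.
- by move=> s; apply: supported_flip; rewrite -mem_cells.
- by move=> s bs u uc; rewrite /entry absl_flip_cell; apply: bs.
- exact: flip_cellK.
Qed.

Lemma admissible_sum_zero (R : comNzRingType) lam N (q t : R) x a r : is_partition lam -> (a < r)%N ->
  \sum_(e | admissible lam a r (@fill lam N e) && has isSome (pattern lam a r (fill e)))
    weight lam q t x (fill e) = 0.
Proof.
move=> lamP ar; set n := size (block lam r).
rewrite (sum_fiber _ _ (words_uniq n) (key := fun e => pattern lam a r (@fill lam N e))); last first.
  by move=> e _; rewrite mem_words size_map.
transitivity (\sum_(p <- words n | has isSome p)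
    (-1) ^+ pneg p * t ^+ coinv p * pattern_sum lam N q t x a r p).
  rewrite [RHS]big_mkcond; apply: eq_bigr => p _; case: ifP => hp; last first.
    by rewrite big_pred0 // => e; case: eqP => [->|]; rewrite ?hp ?andbF.
  rewrite /pattern_sum mulr_sumr; apply: eq_big => [e|e /andP[/andP[adm _] /eqP pe]].
    by case: eqP => [->|]; rewrite ?hp ?andbT ?andbF.
  rewrite (@weight_pattern _ _ _ _ _ a r) ?pe // -pe.
  exact: coinv_le_quinv (fill_supported e) ar adm.
rewrite big_seq_cond (sum_fiber _ _ (iota_uniq 0 n.+1) (key := nsome)); last first.
  move=> p /andP[]; rewrite mem_words mem_iota => /eqP <- _ /=.
  by rewrite add0n ltnS; apply: count_size.
rewrite big1 // => -[|m] _.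
  by apply: big_pred0 => p; rewrite has_count -/(nsome p); case: (nsome p) => [|k]; rewrite ?andbF.
have inv := pattern_invariant
  (fun u y z v => pattern_sum_swap N q t x u y z v lamP ar)
  (fun b w => pattern_sum_flip N q t x b w lamP ar).
(* All words of length [n] with [m+1] letters [Some] have the same [pattern_sum], here taken at one
   chosen representative, so it factors out. *)
transitivity (word_sum t n m.+1 1 * pattern_sum lam N q t x a r
   (nseq m.+1 (Some false) ++ nseq (n - m.+1) None)); last by rewrite word_sum1 // mul0r.
rewrite /word_sum mulr_suml [RHS]big_seq_cond; apply: eq_big => [p|p].
  by rewrite has_count -/(nsome p) -andbA; congr (_ && _); case: eqP => [->|]; rewrite ?andbF.
rewrite mem_words => /andP[/andP[/eqP sp _] /eqP np]; congr (_ * _).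
have mn : (m < n)%N by rewrite -np -sp; apply: count_size.
apply: inv; first by rewrite size_cat !size_nseq sp; lia.
by rewrite np /nsome count_cat !count_nseq /=; lia.
Qed.

Theorem mainTheorem12 (R : comNzRingType) (lam : seq nat) :
  is_partition lam ->
  forall (N : nat) (q t : R) (x : nat -> R),
    \sum_(e : (size (cells lam)).-tuple ('I_N * bool)
            | phi_degenerate lam (@fill lam N e))
       weight lam q t x (@fill lam N e) = 0.
Proof.
move=> lamP N q t x.
pose key (e : (size (cells lam)).-tuple ('I_N * bool)) := dkey lam (fill e).
(* The sum is split by distinguished label and row, over the finite list of keys that occur. *)
rewrite (sum_fiber _ _ (undup_uniq (map key (enum predT))) (key := key)); last first.
  by move=> e _; rewrite mem_undup; apply: map_f; rewrite mem_enum.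
have sp e : positive lam (@fill lam N e) by move=> u uc; have /andP[] := fill_bounded e uc.
have keyP e : phi_degenerate lam (fill e) -> isSome (key e).1 && isSome (key e).2.
  rewrite /key /dkey /phi_degenerate.
  by case: (dlabel lam (fill e)) => // b; case: (dcell lam (fill e) b).
rewrite big1 // => -[oa or] _.
have [|ko] := boolP (isSome oa && isSome or); last first.
  by apply: big_pred0 => e; apply/negbTE/negP => /andP[/keyP + /eqP ke]; rewrite ke (negbTE ko).
case: oa or => [a|] [r|] // _.
(* The conditions on [a < r] and on the size of the block do not involve the filling: if one fails,
   the fiber is empty. *)
under eq_bigl do rewrite phi_degenerate_key //.
have [ar|ar] := boolP (a < r)%N; last by rewrite big_pred0.
have [br|br] := boolP (1 < size (block lam r))%N; last by rewrite big_pred0.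
exact: admissible_sum_zero.
Qed.
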